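(* There exists $m_0$ such that for every $m>m_0$ the $(4,2)$-hypercontractive constant satisfies $\sigma_{4,2}(\mu,\mathfrak S_m)\geq m^{-1/2}$. Equivalently: for every $m>m_0$, every $t\geq\frac12\ln m$ and every $f\in\mathfrak S_m$, $$\big\|(1-e^{-t})\,\mathbb E_\mu f+e^{-t}f\big\|_{L_4(\mu)}\leq\|f\|_{L_2(\mu)}.$$
   Context: $\mu$ is the uniform probability measure on the symmetric group $S_m$ and $\|f\|_{L_p(\mu)}=(\mathbb E_{x\sim\mu}|f(x)|^p)^{1/p}$. $\mathfrak S_m$ is the space of real functions on $S_m$ whose Fourier transform is supported on the trivial and the standard $(m-1)$-dimensional irreducible representations; equivalently, the linear span of the functions $x\mapsto\mathbf 1_{x(a)=b}$, $a,b\in[m]$. For $t\geq0$, $T_tf=(1-e^{-t})\mathbb E_\mu f+e^{-t}f$. The hypercontractive constant $\sigma_{4,2}(\mu,\mathfrak S_m)$ is $e^{-t_0}$, where $t_0$ is the least number such that $\|T_tf\|_{L_4(\mu)}\leq\|f\|_{L_2(\mu)}$ for all $t\ge t_0$ and all $f\in\mathfrak S_m$. *)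

(* Defs.v *)
From HB Require Import structures.
From mathcomp Require Import all_boot all_order all_algebra all_fingroup all_character.
From mathcomp Require Import all_classical all_reals all_analysis.
Set Implicit Arguments.
Unset Strict Implicit.
Unset Printing Implicit Defensive.
Import Order.TTheory GRing.Theory Num.Theory.
Local Open Scope ring_scope.

Definition mean_Sm (R : realType) (m : nat) (f : 'S_m -> R) : R :=
  (\sum_(x : 'S_m) f x) / #|{: 'S_m}|%:R.

Definition Lp_norm (R : realType) (m : nat) (p : R) (f : 'S_m -> R) : R :=
  (mean_Sm (fun x => `|f x| `^ p)) `^ p^-1.

Definition noise (R : realType) (m : nat) (t : R) (f : 'S_m -> R) : 'S_m -> R :=
  fun x => (1 - expR (- t)) * mean_Sm f + expR (- t) * f x.

Lemma triv_mx_repr (R : realType) (m : nat) :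
  mx_repr [set: 'S_m] (fun _ : 'S_m => 1%:M : 'M[R]_1).
Proof. by split=> // x y _ _; rewrite mulmx1. Qed.

Definition triv_repr (R : realType) (m : nat) :
    mx_representation R [set: 'S_m] 1 :=
  MxRepresentation (@triv_mx_repr R m).

Lemma perm_mx_repr (R : realType) (m : nat) :
  mx_repr [set: 'S_m] (fun x : 'S_m => perm_mx x : 'M[R]_m).
Proof. by split=> [|x y _ _]; rewrite ?perm_mx1 ?perm_mxM. Qed.

Definition perm_repr (R : realType) (m : nat) :
    mx_representation R [set: 'S_m] m :=
  MxRepresentation (@perm_mx_repr R m).

(* The row space of this matrix is the space of vectors with coordinate sum 0. *)
Definition sum0_mx (R : realType) (m : nat) : 'M[R]_m :=
  kermx (const_mx 1 : 'cV[R]_m).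

Lemma sum0_mxmodule (R : realType) (m : nat) :
  mxmodule (perm_repr R m) (sum0_mx R m).
Proof.
apply/mxmoduleP => x _; apply/sub_kermxP; rewrite -mulmxA.
have -> : perm_repr R m x *m const_mx 1 = const_mx 1 :> 'cV[R]_m.
  by rewrite /= -row_permE; apply/matrixP => i j; rewrite !mxE.
exact: mulmx_ker.
Qed.

(* Its degree \rank (sum0_mx R m) is m - 1. *)
Definition std_repr (R : realType) (m : nat) :
    mx_representation R [set: 'S_m] (\rank (sum0_mx R m)) :=
  submod_repr (sum0_mxmodule R m).

Definition fourier (R : realType) (m n : nat) (f : 'S_m -> R)
    (rho : mx_representation R [set: 'S_m] n) : 'M[R]_n :=
  \sum_(x : 'S_m) f x *: rho x.

(* Real representations suffice: every complex irreducible representation of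
   'S_m is realizable over the rationals. *)
Definition fourier_std (R : realType) (m : nat) (f : 'S_m -> R) : Prop :=
  forall (n : nat) (rho : mx_representation R [set: 'S_m] n),
    mx_irreducible rho -> ~ mx_rsim rho (triv_repr R m) ->
    ~ mx_rsim rho (std_repr R m) -> fourier f rho = 0.

Definition hypercontractive_time (R : realType) (m : nat) (t : R) : Prop :=
  forall f : 'S_m -> R, fourier_std f ->
    Lp_norm 4 (noise t f) <= Lp_norm 2 f.

Definition hypercontractive_from (R : realType) (m : nat) : set R :=
  [set t0 : R | 0 <= t0 /\
    forall t, t0 <= t -> hypercontractive_time m t]%classic.

(* The constant is e^{-t0} with t0 the least element of the set above. That set
   is closed, bounded below by 0, and nonempty because the function space is
   finite-dimensional, so its infimum is its least element (the library value
   [inf set0 = 0] is not reached). *)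
Definition sigma42 (R : realType) (m : nat) : R :=
  expR (- inf (@hypercontractive_from R m)).

(* Main.v *)
(* Write f = c + g with g of mean 0. The Fourier condition forces
   g x = \sum_a M a (x a) for a matrix M with zero row and column sums. The
   random permutations x and (i j) x, with i, j uniform, form an exchangeable
   pair along which g contracts by a constant factor; Stein's argument then
   gives E g^2 >= |M|^2 / 2m and E g^4 <= 6 (1 + 1/m) |M|^2 E g^2, so that
   E g^4 <= 12 (m + 1) (E g^2)^2. With s = e^{-t} <= m^{-1/2},
   (c + s g)^4 <= c^4 + 4 c^3 s g + 8 c^2 s^2 g^2 + 3 s^4 g^4 pointwise, and
   the mean of the right-hand side is at most (c^2 + E g^2)^2 for m >= 40. *)
Require Import Defs.
From mathcomp Require Import all_boot all_order all_algebra all_fingroup all_character.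
From mathcomp Require Import all_classical all_reals all_analysis.
From mathcomp Require Import ring lra.
Import Order.TTheory GRing.Theory Num.Theory.
Local Open Scope ring_scope.

(** * Fourier support and the span of the permutation matrix entries *)

Section FourierSm.
Context {R : realType} {m : nat}.
Implicit Types f h phi : 'S_m -> R.

Lemma fourier_rsim f n1 n2 (rho1 : mx_representation R [set: 'S_m] n1)
    (rho2 : mx_representation R [set: 'S_m] n2) :
  mx_rsim rho1 rho2 -> fourier f rho2 = 0 -> fourier f rho1 = 0.
Proof.
move=> /mx_rsim_def[B [B' _ E]] f0.
transitivity (B *m fourier f rho2 *m B'); last by rewrite f0 mulmx0 mul0mx.
rewrite /fourier mulmx_sumr mulmx_suml; apply: eq_bigr => x _.
by rewrite E ?inE // -scalemxAr -scalemxAl.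
Qed.

Lemma val_submod_fourier f n (rho : mx_representation R [set: 'S_m] n)
    (U : 'M[R]_n) (modU : mxmodule rho U) k (W : 'M[R]_(k, \rank U)) :
  val_submod (W *m fourier f (submod_repr modU)) =
  val_submod W *m fourier f rho.
Proof.
rewrite /fourier !mulmx_sumr linear_sum; apply: eq_bigr => x _.
by rewrite -!scalemxAr linearZ /= val_submodJ ?inE.
Qed.

Lemma fourier_submod_eq0 f n (rho : mx_representation R [set: 'S_m] n)
    (U : 'M[R]_n) (modU : mxmodule rho U) :
  fourier f rho = 0 -> fourier f (submod_repr modU) = 0.
Proof.
move=> f0; rewrite -[LHS]mul1mx; apply: (can_inj (val_submodK (U := U))).
by rewrite val_submod_fourier f0 mulmx0 linear0.
Qed.

(** Maschke's theorem in characteristic 0: the module is a sum of simple submodules, and the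
    transform kills each of them. *)
Lemma fourier_irr_eq0 f :
  (forall n (rho : mx_representation R [set: 'S_m] n),
     mx_irreducible rho -> fourier f rho = 0) ->
  forall n (rho : mx_representation R [set: 'S_m] n), fourier f rho = 0.
Proof.
move=> irr0 n rho.
have redV : mx_completely_reducible rho 1%:M.
  apply: mx_Maschke_pchar.
  by apply: etrans (pcharf'_nat R _) _; rewrite pnatr_eq0 -lt0n cardG_gt0.
(* The semisimple decomposition comes under [classically], so the goal is first made boolean. *)
apply/eqP; apply: (mx_reducible_semisimple (mxmodule1 rho) redV).
case=> I U W simU WV _.
rewrite -(submx0 (fourier f rho)) -[fourier f rho]mul1mx.
apply: submx_trans (submxMr _ (_ : (1%:M <= W)%MS)) _; first by rewrite WV.
rewrite /W sumsmxMr; apply/sumsmx_subP => i _.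
have [modU _ _] := simU i.
have irrU : mx_irreducible (submod_repr modU) by apply/submod_mx_irr.
rewrite -(eqmxMr _ (val_submod1 (U i))) -val_submod_fourier.
by rewrite irr0 // mulmx0 linear0 sub0mx.
Qed.

(** Factoring [rho z] as [rho (z * y)] times [rho y^-1] separates the two sums; hence the inverse in
    the second factor. *)
Lemma fourier_corr f h n (rho : mx_representation R [set: 'S_m] n) :
  fourier (fun z => \sum_y f (z * y)%g * h y) rho =
  fourier f rho *m fourier (fun y => h y^-1%g) rho.
Proof.
rewrite /fourier [RHS]mulmx_suml.
under eq_bigr do rewrite scaler_suml.
rewrite exchange_big /=.
under [RHS]eq_bigr do rewrite mulmx_sumr.
rewrite [RHS]exchange_big /= [RHS](reindex_inj invg_inj) /=.
apply: eq_bigr => y _.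
rewrite [RHS](reindex_inj (mulIg y)) /=; apply: eq_bigr => z _.
by rewrite invgK -scalemxAr -scalemxAl scalerA mulrC -repr_mxM ?inE // mulgK.
Qed.

(** Only the identity fixes the basis vector indexed by 1, so the diagonal entry of the transform
    there is [f 1]. *)
Lemma fourier_regular_eq0 f :
  fourier f (regular_repr R [set: 'S_m]) = 0 -> f 1%g = 0.
Proof.
pose k := gring_index [set: 'S_m] 1%g.
move=> /matrixP/(_ k k); rewrite mxE /fourier summxE (bigD1 1%g) //=.
rewrite big1 => [|x nx1]; rewrite !mxE gring_indexK ?inE // ?mul1g.
  by rewrite !eqxx mulr1 addr0.
rewrite -/k eqxx andTb; case: eqP => [/(congr1 enum_val)|]; last by rewrite mulr0.
by rewrite !gring_indexK ?inE // => x1; rewrite x1 eqxx in nx1.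
Qed.

(** Transposing a permutation matrix inverts the permutation. *)
Lemma fourier_perm_eq0_inv phi :
  fourier phi (perm_repr R m) = 0 ->
  fourier (fun x => phi x^-1%g) (perm_repr R m) = 0.
Proof.
move=> f0; rewrite -[RHS]trmx0 -[in RHS]f0 /fourier linear_sum /=.
rewrite [LHS](reindex_inj invg_inj) /=; apply: eq_bigr => x _.
by rewrite invgK linearZ /= tr_perm_mx.
Qed.

(** Each row of a permutation matrix sums to 1, so a row sum of the one transform is the other. *)
Lemma fourier_perm_eq0_triv phi : (0 < m)%N ->
  fourier phi (perm_repr R m) = 0 -> fourier phi (triv_repr R m) = 0.
Proof.
move=> m0 f0; pose i0 := Ordinal m0.
apply/matrixP => i j; rewrite !ord1 /fourier summxE mxE.
transitivity (\sum_k (fourier phi (perm_repr R m)) i0 k); last first.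
  by rewrite f0 big1 // => k _; rewrite mxE.
rewrite /fourier; under [RHS]eq_bigr do rewrite summxE.
rewrite exchange_big; apply: eq_bigr => x _ /=.
rewrite (bigD1 (x i0)) //= big1 => [|k kx]; rewrite !mxE ?eqxx ?addr0 //.
by rewrite eq_sym (negbTE kx) mulr0.
Qed.

(* Every irreducible representation kills f or phi, hence the group algebra
   product of f and the reflected phi, whose coefficient at 1 is the inner
   product. *)
Lemma fourier_std_orthogonal f phi : (0 < m)%N -> fourier_std f ->
  fourier phi (perm_repr R m) = 0 -> \sum_x f x * phi x = 0.
Proof.
move=> m0 stdf phi0; have phi0' := fourier_perm_eq0_inv phi phi0.
have := fourier_regular_eq0 (fun z => \sum_y f (z * y)%g * phi y).
under eq_bigr do rewrite mul1g; apply.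
apply: fourier_irr_eq0 => n rho irr; rewrite fourier_corr.
have [rt|nrt] := pselect (mx_rsim rho (triv_repr R m)).
  by rewrite [X in _ *m X](fourier_rsim _ _ _ _ _ rt) ?mulmx0 // fourier_perm_eq0_triv.
have [rs|nrs] := pselect (mx_rsim rho (std_repr R m)).
  by rewrite [X in _ *m X](fourier_rsim _ _ _ _ _ rs) ?mulmx0 // fourier_submod_eq0.
by rewrite stdf // mul0mx.
Qed.

(** Linear duality: a function lies in the span of the permutation matrix entries once it is
    orthogonal to everything orthogonal to that span. *)
Lemma fourier_std_perm_stat f : (0 < m)%N -> fourier_std f ->
  exists A : 'M[R]_m, forall x, f x = \sum_a A a (x a).
Proof.
move=> m0 stdf.
pose B := \matrix_(i < #|{: 'S_m}|) mxvec (perm_mx (enum_val i) : 'M[R]_m).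
pose F : 'rV[R]_#|{: 'S_m}| := \row_i f (enum_val i).
have /submxP[c Fc] : (F <= B^T)%MS.
  rewrite submxE; apply/eqP/rowP => j; rewrite !mxE.
  (* A column of the cokernel read as a function on the group; [B^T *m cokermx B^T = 0] says that
     its transform at [perm_repr] vanishes. *)
  pose phi x := cokermx B^T (enum_rank x) j.
  rewrite (reindex (@enum_rank 'S_m)) /=; last first.
    by exists enum_val => x _; rewrite ?enum_rankK ?enum_valK.
  under eq_bigr do rewrite mxE enum_rankK -/(phi _).
  apply: fourier_std_orthogonal => //.
  apply: (can_inj mxvecK); rewrite linear0 /fourier linear_sum /=.
  have cokerj k : (B^T *m cokermx B^T) k j = 0 by rewrite mulmx_coker mxE.
  apply/rowP => k; rewrite summxE [RHS]mxE.
  apply: etrans (cokerj k); rewrite [RHS]mxE.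
  rewrite [RHS](reindex (@enum_rank 'S_m)) /=; last first.
    by exists enum_val => x _; rewrite ?enum_rankK ?enum_valK.
  by apply: eq_bigr => x _; rewrite linearZ mxE mulrC /phi; congr (_ * _); rewrite !mxE enum_rankK.
exists (vec_mx c) => x.
have -> : f x = (c *m (mxvec (perm_mx x))^T) 0 0.
  have /rowP/(_ (enum_rank x)) := Fc; rewrite mxE enum_rankK => ->.
  by rewrite !mxE; apply: eq_bigr => k _; rewrite !mxE enum_rankK.
rewrite mxE (reindex _ (curry_mxvec_bij m m)) /=.
transitivity (\sum_(p : 'I_m * 'I_m)
    vec_mx c p.1 p.2 * (perm_mx x : 'M[R]_m) p.1 p.2).
  apply: eq_bigr => -[a b] _ /=.
  by rewrite [X in _ * X]mxE mxvecE -[in LHS](vec_mxK c) mxvecE.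
rewrite -(pair_bigA _ (fun a b => vec_mx c a b * (perm_mx x : 'M[R]_m) a b)) /=.
apply: eq_bigr => a _.
rewrite (bigD1 (x a)) //= big1 => [|b bx]; rewrite !mxE.
  by rewrite eqxx mulr1 addr0.
by rewrite eq_sym (negbTE bx) mulr0.
Qed.

End FourierSm.

(** * Second and fourth moments of a permutation statistic by exchangeable pairs *)

Section Statistic.
Context {R : realType} {m : nat} (M : 'M[R]_m).

(** Hoeffding's combinatorial statistic. *)
Definition perm_stat (x : 'S_m) : R := \sum_a M a (x a).

Definition swap_diff (x : 'S_m) (i j : 'I_m) : R :=
  M i (x i) + M j (x j) - M i (x j) - M j (x i).

Lemma perm_stat_tperm (x : 'S_m) (i j : 'I_m) :
  perm_stat x - perm_stat (tperm i j * x)%g = swap_diff x i j.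
Proof.
rewrite /perm_stat -sumrB /swap_diff.
have [<-|nij] := eqVneq i j.
  rewrite big1 => [|a _]; first by ring.
  by rewrite permM tperm1 perm1 subrr.
rewrite (bigD1 i) //= (bigD1 j) 1?eq_sym //= big1 => [|a /andP[ai aj]].
  by rewrite !permM tpermL tpermR; ring.
by rewrite permM tpermD ?subrr // eq_sym.
Qed.

Lemma sum_tperm (h : 'S_m -> R) (i j : 'I_m) :
  \sum_x h (tperm i j * x)%g = \sum_x h x.
Proof. by rewrite [RHS](reindex_inj (mulgI (tperm i j))). Qed.

(** Composing with [tperm a b] shows that the sum does not depend on [a], so it may be averaged over
    all points. *)
Lemma sum_perm_app (h : 'I_m -> R) (a : 'I_m) :
  m%:R * (\sum_(x : 'S_m) h (x a)) = #|{: 'S_m}|%:R * \sum_b h b.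
Proof.
transitivity (\sum_(b < m) \sum_(x : 'S_m) h (x b)).
  rewrite mulr_natl -[in X in _ *+ X](card_ord m) -sumr_const.
  apply: eq_bigr => b _.
  rewrite -(sum_tperm _ a b); apply: eq_bigr => x _.
  by rewrite permM tpermL.
rewrite exchange_big /= (eq_bigr (fun=> \sum_b h b)) => [|x _].
  by rewrite sumr_const mulr_natl.
by rewrite [RHS](reindex_inj (@perm_inj _ x)).
Qed.

(** Exchangeability of the pair: a transposition is an involution. *)
Lemma sum_sum_sym (F : 'S_m -> 'S_m -> R) :
  \sum_(i < m) \sum_(j < m) \sum_x F x (tperm i j * x)%g =
  \sum_(i < m) \sum_(j < m) \sum_x F (tperm i j * x)%g x.
Proof.
apply: eq_bigr => i _; apply: eq_bigr => j _.
rewrite -(sum_tperm _ i j); apply: eq_bigr => x _.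
by rewrite mulgA tperm2 mul1g.
Qed.

Hypothesis row0 : forall a, \sum_b M a b = 0.
Hypothesis col0 : forall b, \sum_a M a b = 0.

Lemma row0_perm (x : 'S_m) a : \sum_b M a (x b) = 0.
Proof. by rewrite -[RHS](row0 a) [RHS](reindex_inj (@perm_inj _ x)) /=. Qed.

(** Stein's linearity condition: over uniform i, j the mean drop of g is (2/m) g(x), because the
    cross terms cancel along the null rows and columns. *)
Lemma sum_swap_diff x : \sum_i \sum_j swap_diff x i j = 2 * m%:R * perm_stat x.
Proof.
under eq_bigr => i _.
  rewrite /swap_diff !sumrB big_split /= sumr_const card_ord col0 row0_perm.
  over.
transitivity (\sum_i (m%:R * M i (x i) + perm_stat x)).
  by apply: eq_bigr => i _; rewrite !subr0 mulr_natl.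
rewrite big_split /= -mulr_sumr sumr_const card_ord -/(perm_stat x) -mulr_natl.
ring.
Qed.

Lemma sum_perm_stat : \sum_x perm_stat x = 0.
Proof.
rewrite exchange_big /= big1 // => a _.
have m0 : m%:R != 0 :> R by rewrite pnatr_eq0 -lt0n (leq_ltn_trans _ (ltn_ord a)).
by apply: (mulfI m0); rewrite sum_perm_app row0 !mulr0.
Qed.

(* Antisymmetrize p (g x) (g x - g x') under the exchange of x and x'. *)
Lemma exchangeable_pair (p : R -> R) :
  4 * m%:R * (\sum_x p (perm_stat x) * perm_stat x) =
  \sum_i \sum_j \sum_x
    (p (perm_stat x) - p (perm_stat (tperm i j * x)%g)) * swap_diff x i j.
Proof.
pose g := perm_stat.
pose F x y := p (g x) * (g x - g y).
have -> : 4 * m%:R * (\sum_x p (g x) * g x) =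
   2 * \sum_(i < m) \sum_(j < m) \sum_x F x (tperm i j * x)%g.
  under [in RHS]eq_bigr do rewrite exchange_big /=.
  rewrite exchange_big /= !mulr_sumr; apply: eq_bigr => x _.
  under eq_bigr => i _ do under eq_bigr => j _ do
    rewrite /F perm_stat_tperm.
  under eq_bigr do rewrite -mulr_sumr.
  rewrite -mulr_sumr sum_swap_diff /g; ring.
rewrite mulr_natl mulr2n {2}sum_sum_sym -big_split /=.
apply: eq_bigr => i _; rewrite -big_split; apply: eq_bigr => j _.
rewrite -big_split; apply: eq_bigr => x _ /=.
by rewrite -perm_stat_tperm /F /g; ring.
Qed.

Let frob : R := \sum_a \sum_b M a b ^+ 2.
Let diag_sqr (x : 'S_m) : R := \sum_a M a (x a) ^+ 2.

Lemma diag_le_frob x : diag_sqr x <= frob.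
Proof.
apply: ler_sum => a _; rewrite (bigD1 (x a)) //= lerDl.
by apply: sumr_ge0 => b _; exact: sqr_ge0.
Qed.

Lemma sum_diag : m%:R * (\sum_x diag_sqr x) = #|{: 'S_m}|%:R * frob.
Proof.
rewrite /diag_sqr /frob exchange_big /= !mulr_sumr; apply: eq_bigr => a _.
exact: (sum_perm_app (fun b => M a b ^+ 2) a).
Qed.

Lemma frob_perm (x : 'S_m) : \sum_i \sum_j M i (x j) ^+ 2 = frob.
Proof.
by apply: eq_bigr => i _; rewrite [RHS](reindex_inj (@perm_inj _ x)).
Qed.

Lemma sum_const2 (h : 'I_m -> R) : \sum_i \sum_(j < m) h i = m%:R * \sum_i h i.
Proof.
rewrite mulr_sumr; apply: eq_bigr => i _.
by rewrite sumr_const card_ord mulr_natl.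
Qed.

(** Cauchy-Schwarz on four terms: each of the two diagonal squares contributes at most m [frob] and
    each of the other two exactly [frob]. *)
Lemma sum_swap_diff_sqr_le x :
  \sum_i \sum_j swap_diff x i j ^+ 2 <= 8 * (m%:R + 1) * frob.
Proof.
apply: (@le_trans _ _ (\sum_i \sum_j 4 * (M i (x i) ^+ 2 + M j (x j) ^+ 2 +
    M i (x j) ^+ 2 + M j (x i) ^+ 2))).
  apply: ler_sum => i _; apply: ler_sum => j _; rewrite /swap_diff.
  set a := M i (x i); set b := M j (x j); set c := M i (x j); set d := M j _.
  have := sqr_ge0 (a - b); have := sqr_ge0 (a + c); have := sqr_ge0 (a + d).
  have := sqr_ge0 (b + c); have := sqr_ge0 (b + d); have := sqr_ge0 (c - d).
  by nra.
under eq_bigr do rewrite -mulr_sumr !big_split /=.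
rewrite -mulr_sumr !big_split /= [X in _ + X]exchange_big /= frob_perm.
rewrite [X in _ + X + _ + _]exchange_big /= sum_const2.
have := diag_le_frob x; rewrite /diag_sqr; set q := \sum_i _ => qK.
have : m%:R * q <= m%:R * frob by rewrite ler_wpM2l.
by nra.
Qed.

Lemma sum_swap_diff_sqr_ge x :
  2 * m%:R * diag_sqr x <= \sum_i \sum_j swap_diff x i j ^+ 2.
Proof.
pose A i j := M i (x j).
have rA i : \sum_j A i j = 0 by exact: row0_perm.
have cA j : \sum_i A i j = 0 by exact: col0.
(* [h i j + h j i] is the expanded square of [swap_diff x i j] without [(A i j + A j i) ^+ 2], and
   its terms mixing diagonal and off-diagonal entries sum to 0. *)
pose h i j := A i i ^+ 2 + A i i * A j j - 2 * A i i * (A i j + A j i).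
have sum_h : \sum_i \sum_j h i j = m%:R * diag_sqr x + perm_stat x ^+ 2.
  under eq_bigr => i _.
    rewrite /h sumrB big_split /= sumr_const card_ord -!mulr_sumr.
    rewrite big_split /= rA cA addr0 mulr0 subr0.
    over.
  by rewrite big_split /= sumrMnl -mulr_suml mulr_natl.
have -> : 2 * m%:R * diag_sqr x =
    \sum_i \sum_j h i j + \sum_i \sum_j h j i - 2 * perm_stat x ^+ 2.
  rewrite [\sum_i \sum_j h j i]exchange_big /= sum_h; ring.
apply: (@le_trans _ _ (\sum_i \sum_j h i j + \sum_i \sum_j h j i)).
  by rewrite gerBl mulr_ge0 // sqr_ge0.
rewrite -big_split /=; apply: ler_sum => i _.
rewrite -big_split /=; apply: ler_sum => j _.
rewrite /h /swap_diff -/(A i i) -/(A j j) -/(A i j) -/(A j i).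
have := sqr_ge0 (A i j + A j i); nra.
Qed.

(** The exchangeable pair identity with p(u) = u turns the second moment into a sum of squared swap
    differences. *)
Lemma frob_le_sum_sqr :
  #|{: 'S_m}|%:R * frob <= 2 * m%:R * \sum_x perm_stat x ^+ 2.
Proof.
rewrite -sum_diag -(ler_pM2l (_ : 0 < 2)) //.
have := exchangeable_pair id => E.
have -> : 2 * (2 * m%:R * \sum_x perm_stat x ^+ 2) =
    \sum_x \sum_i \sum_j swap_diff x i j ^+ 2.
  transitivity (4 * m%:R * \sum_x perm_stat x * perm_stat x).
    by rewrite mulrA; congr (_ * _); ring.
  rewrite E; under [in RHS]eq_bigr do under eq_bigr do under eq_bigr do
    rewrite -perm_stat_tperm expr2.
  rewrite [RHS]exchange_big /=; apply: eq_bigr => i _.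
  rewrite [RHS]exchange_big /=; apply: eq_bigr => j _.
  by apply: eq_bigr => x _; rewrite perm_stat_tperm.
rewrite mulrA mulr_sumr; apply: ler_sum => x _.
exact: sum_swap_diff_sqr_ge.
Qed.

(** The same identity with p(u) = u^3; the bound on the sum of squared differences is uniform in x,
    so g(x)^2 factors out. *)
Lemma sum_pow4_le_frob :
  m%:R * (\sum_x perm_stat x ^+ 4) <=
  6 * (m%:R + 1) * frob * \sum_x perm_stat x ^+ 2.
Proof.
pose g := perm_stat.
pose G x y := (g x - g y) ^+ 2 * g x ^+ 2.
have E := exchangeable_pair (fun u => u ^+ 3).
have sumG : \sum_i \sum_j \sum_x G x (tperm i j * x)%g <=
    8 * (m%:R + 1) * frob * \sum_x g x ^+ 2.
  under eq_bigr do rewrite exchange_big /=.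
  rewrite exchange_big /= mulr_sumr; apply: ler_sum => x _.
  under eq_bigr do under eq_bigr do rewrite /G perm_stat_tperm.
  under eq_bigr do rewrite -mulr_suml.
  by rewrite -mulr_suml ler_wpM2r ?sqr_ge0 ?sum_swap_diff_sqr_le.
have : 4 * m%:R * (\sum_x g x ^+ 4) <=
    3 / 2 * (\sum_i \sum_j \sum_x G x (tperm i j * x)%g +
             \sum_i \sum_j \sum_x G (tperm i j * x)%g x).
  have -> : \sum_x g x ^+ 4 = \sum_x g x ^+ 3 * g x.
    by apply: eq_bigr => x _; rewrite -exprSr.
  rewrite E -big_split mulr_sumr; apply: ler_sum => i _ /=.
  rewrite -big_split mulr_sumr; apply: ler_sum => j _ /=.
  rewrite -big_split mulr_sumr; apply: ler_sum => x _ /=.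
  rewrite /G -perm_stat_tperm -/(g x) -/(g (tperm i j * x)%g).
  set a := g x; set b := g _.
  (* (3/2) (a - b)^2 (a^2 + b^2) - (a^3 - b^3) (a - b) = (a - b)^4 / 2. *)
  have : 0 <= ((a - b) ^+ 2) ^+ 2 by exact: sqr_ge0.
  by nra.
rewrite -sum_sum_sym -/g.
set S4 := \sum_x g x ^+ 4; set S2 := \sum_x g x ^+ 2 in sumG *.
set Z := \sum_i _ in sumG *.
by nra.
Qed.

Lemma perm_stat_pow4_le :
  #|{: 'S_m}|%:R * (\sum_x perm_stat x ^+ 4) <=
  12 * (m%:R + 1) * (\sum_x perm_stat x ^+ 2) ^+ 2.
Proof.
(* Both sides vanish for m = 0; otherwise a factor m is cancelled. *)
have [m0|m_gt0] := posnP m.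
  rewrite !big1 ?expr0n ?mulr0 // => x _; rewrite /perm_stat big1 ?expr0n //;
    by move=> a; exfalso; have := ltn_ord a; rewrite {2}m0.
have mR : 0 < m%:R :> R by rewrite ltr0n.
rewrite -(ler_pM2l mR) mulrCA.
have H4 := sum_pow4_le_frob; have H2 := frob_le_sum_sqr.
set S4 := \sum_x _ in H4 *; set S2 := \sum_x _ in H2 H4 *.
have S2_ge0 : 0 <= S2 by apply: sumr_ge0 => x _; exact: sqr_ge0.
have n0 : 0 <= #|{: 'S_m}|%:R :> R by [].
set n := #|_|%:R in n0 H2 *.
apply: le_trans (ler_wpM2l n0 H4) _.
have c0 : 0 <= 6 * (m%:R + 1) * S2 by rewrite !mulr_ge0 // addr_ge0 // ltW.
have := ler_wpM2l c0 H2; lra.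
Qed.

End Statistic.

(** * Centering, and the fourth moment after noise *)

Lemma double_centering {R : realType} {m : nat} (A : 'M[R]_m) : (0 < m)%N ->
  exists (c : R) (M : 'M[R]_m),
    [/\ forall a, \sum_b M a b = 0, forall b, \sum_a M a b = 0 &
        forall x : 'S_m, \sum_a A a (x a) = c + perm_stat M x].
Proof.
move=> m_gt0; have mR : m%:R != 0 :> R by rewrite pnatr_eq0 -lt0n.
pose r a := \sum_b A a b; pose k b := \sum_a A a b.
pose tot := \sum_a r a.
have totk : \sum_b k b = tot by rewrite /tot /r exchange_big.
have sumc (z : R) : \sum_(i < m) z = m%:R * z.
  by rewrite sumr_const card_ord mulr_natl.
exists (tot / m%:R).
(* Along a permutation the row and column corrections each total [tot / m], and the last term gives
   one of them back; hence the constant. *)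
exists (\matrix_(a, b) (A a b - r a / m%:R - k b / m%:R + tot / m%:R ^+ 2)).
split=> [a|b|x].
- under eq_bigr do rewrite mxE.
  rewrite big_split !sumrB /= !sumc -/(r a) -mulr_suml totk; field.
  exact: mR.
- under eq_bigr do rewrite mxE.
  rewrite big_split !sumrB /= !sumc -/(k b) -mulr_suml -/tot; field.
  exact: mR.
- rewrite /perm_stat; under [in RHS]eq_bigr do rewrite mxE.
  rewrite big_split !sumrB /= !sumc -!mulr_suml -/tot.
  have -> : \sum_a k (x a) = tot.
    by rewrite -totk [RHS](reindex_inj (@perm_inj _ x)).
  field; exact: mR.
Qed.

(** The cubic term, whose mean is not controlled, is absorbed by 4 c s^3 g^3 <= 2 c^2 s^2 g^2 + 2
    s^4 g^4. *)
Lemma pow4_noise_le {R : realType} (c s g : R) :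
  (c + s * g) ^+ 4 <=
  c ^+ 4 + 4 * c ^+ 3 * s * g + 8 * c ^+ 2 * s ^+ 2 * g ^+ 2
  + 3 * s ^+ 4 * g ^+ 4.
Proof.
have := sqr_ge0 (c * s * g - s ^+ 2 * g ^+ 2); nra.
Qed.

Section Hypercontractivity.
Context {R : realType} {m : nat}.
Hypothesis m_ge40 : (40 <= m)%N.

Let n : R := #|{: 'S_m}|%:R.

Let n_gt0 : 0 < n.
Proof. by rewrite ltr0n; apply/card_gt0P; exists 1%g. Qed.

Lemma mean_noise_pow4_le (M : 'M[R]_m) (c s : R) :
  (forall a, \sum_b M a b = 0) -> (forall b, \sum_a M a b = 0) ->
  m%:R * s ^+ 2 <= 1 ->
  mean_Sm (fun x => (c + s * perm_stat M x) ^+ 4) <=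
  (mean_Sm (fun x => (c + perm_stat M x) ^+ 2)) ^+ 2.
Proof.
move=> row0 col0 ms; pose g := perm_stat M.
set S2 := \sum_x g x ^+ 2; set S4 := \sum_x g x ^+ 4.
have sumc (z : R) : \sum_(x : 'S_m) z = n * z.
  by rewrite sumr_const mulr_natl.
have S1 : \sum_x g x = 0 by exact: sum_perm_stat.
have S2_ge0 : 0 <= S2 by apply: sumr_ge0 => x _; exact: sqr_ge0.
have S4_le : n * S4 <= 12 * (m%:R + 1) * S2 ^+ 2 by exact: perm_stat_pow4_le.
have -> : mean_Sm (fun x => (c + g x) ^+ 2) = c ^+ 2 + S2 / n.
  rewrite /mean_Sm -/n.
  under eq_bigr do rewrite sqrrD -mulr_natl mulrA.
  rewrite !big_split /= sumc -mulr_sumr S1 -/S2; field.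
  exact: lt0r_neq0.
have mean_le : mean_Sm (fun x => (c + s * g x) ^+ 4) <=
    c ^+ 4 + 8 * c ^+ 2 * s ^+ 2 * (S2 / n) + 3 * s ^+ 4 * (S4 / n).
  rewrite /mean_Sm -/n ler_pdivrMr //.
  apply: le_trans (ler_sum _ (fun x _ => pow4_noise_le c s (g x))) _.
  rewrite !big_split /= sumc -!mulr_sumr S1 -/S2 -/S4 le_eqVlt; apply/orP; left.
  by apply/eqP; field; exact: lt0r_neq0.
apply: le_trans mean_le _.
have m40 : 40 <= m%:R :> R by rewrite ler_nat.
have u_ge0 : 0 <= S2 / n by rewrite divr_ge0 // ltW.
have v_le : S4 / n <= 12 * (m%:R + 1) * (S2 / n) ^+ 2.
  have -> : S4 / n = n * S4 / n ^+ 2 by field; exact: lt0r_neq0.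
  by rewrite expr_div_n mulrA ler_pM2r // invr_gt0 exprn_gt0.
set u := S2 / n in u_ge0 v_le *; set v := S4 / n in v_le *.
have s2_ge0 := sqr_ge0 s; rewrite (_ : s ^+ 4 = (s ^+ 2) ^+ 2); last by ring.
set q := s ^+ 2 in ms s2_ge0 *.
have q40 : 40 * q <= 1 by apply: le_trans ms; rewrite ler_wpM2r.
have cu_le : 8 * c ^+ 2 * q * u <= 2 * c ^+ 2 * u.
  have := mulr_ge0 (sqr_ge0 c) u_ge0; nra.
have qv_le : 3 * q ^+ 2 * v <= u ^+ 2.
  apply: (@le_trans _ _ (3 * q ^+ 2 * (12 * (m%:R + 1) * u ^+ 2))).
    by rewrite ler_wpM2l // mulr_ge0 // sqr_ge0.
  (* With m q <= 1 and 40 q <= 1, 36 q^2 (m + 1) <= 36.9 q < 1; this decides the threshold 40. *)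
  rewrite mulrA -[leRHS]mul1r ler_wpM2r ?sqr_ge0 //.
  have : m%:R * q * q <= q by rewrite -[leRHS]mul1r ler_wpM2r.
  have : q * q <= q by nra.
  nra.
rewrite sqrrD -mulr_natl; lra.
Qed.

End Hypercontractivity.

Lemma Lp_norm4_le {R : realType} {m : nat} (f h : 'S_m -> R) :
  mean_Sm (fun x => h x ^+ 4) <= (mean_Sm (fun x => f x ^+ 2)) ^+ 2 ->
  Lp_norm 4 h <= Lp_norm 2 f.
Proof.
move=> le42; rewrite /Lp_norm.
have -> : mean_Sm (fun x => `|h x| `^ 4) = mean_Sm (fun x => h x ^+ 4).
  congr (_ / _); apply: eq_bigr => x _.
  by rewrite powR_mulrn // -normrX ger0_norm // exprn_even_ge0.
have -> : mean_Sm (fun x => `|f x| `^ 2) = mean_Sm (fun x => f x ^+ 2).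
  congr (_ / _); apply: eq_bigr => x _.
  by rewrite powR_mulrn // -normrX ger0_norm // exprn_even_ge0.
set a := mean_Sm _ in le42 *; set b := mean_Sm _ in le42 *.
have a0 : 0 <= a.
  by rewrite divr_ge0 // sumr_ge0 // => x _; rewrite exprn_even_ge0.
have b0 : 0 <= b by rewrite divr_ge0 // sumr_ge0 // => x _; exact: sqr_ge0.
(* Both norms become fourth roots, which are monotone. *)
have -> : b `^ 2^-1 = (b ^+ 2) `^ 4^-1.
  by rewrite -powR_mulrn // -powRrM; congr (_ `^ _); field.
by apply: ge0_ler_powR => //; rewrite ?nnegrE ?exprn_ge0.
Qed.

Theorem theorem8p14 (R : realType) :
  exists m0 : nat, forall m : nat, (m0 < m)%N ->
    m%:R `^ (- 2^-1) <= sigma42 R m /\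
    (forall t : R, 2^-1 * ln m%:R <= t ->
     forall f : 'S_m -> R, fourier_std f ->
       Lp_norm 4 (noise t f) <= Lp_norm 2 f).
Proof.
(* On naturals [39 < m] is by definition [40 <= m]. *)
exists 39%N => m m_ge40; have m_gt0 : (0 < m)%N by apply: leq_trans m_ge40.
have mR_gt0 : 0 < m%:R :> R by rewrite ltr0n.
have hyper : forall t : R, 2^-1 * ln m%:R <= t ->
    forall f : 'S_m -> R, fourier_std f ->
      Lp_norm 4 (noise t f) <= Lp_norm 2 f.
  move=> t t_ge f stdf.
  have [A fA] := fourier_std_perm_stat f m_gt0 stdf.
  have [c [M [row0 col0 AM]]] := double_centering A m_gt0.
  have {A fA AM} fE x : f x = c + perm_stat M x by rewrite fA AM.
  have n0 : #|{: 'S_m}|%:R != 0 :> R.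
    by rewrite pnatr_eq0 -lt0n; apply/card_gt0P; exists 1%g.
  have mean_f : mean_Sm f = c.
    rewrite /mean_Sm; under eq_bigr do rewrite fE.
    rewrite big_split /= sum_perm_stat // addr0 sumr_const -[c *+ _]mulr_natr.
    by rewrite mulfK.
  have s2 : m%:R * expR (- t) ^+ 2 <= 1.
    rewrite -expRM_natl -ler_pdivlMl // mulr1 -[leRHS]lnK ?posrE ?invr_gt0 //.
    rewrite ler_expR lnV ?posrE //; lra.
  have := mean_noise_pow4_le m_ge40 M c _ row0 col0 s2.
  rewrite (_ : (fun x => (c + expR (- t) * perm_stat M x) ^+ 4) =
    fun x => noise t f x ^+ 4); last first.
    by apply: funext => x; rewrite /noise mean_f fE; congr (_ ^+ 4); ring.
  rewrite (_ : (fun x => (c + perm_stat M x) ^+ 2) = fun x => f x ^+ 2).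
    exact: Lp_norm4_le.
  by apply: funext => x; rewrite fE.
(* As m^(-1/2) = exp(- (ln m) / 2), it suffices that (ln m) / 2 belongs to the set, which is bounded
   below by 0. *)
split=> //; rewrite /sigma42 /powR gt_eqF // ler_expR mulNr lerN2.
apply: ge_inf; first by exists 0 => t [].
by split=> //; rewrite mulr_ge0 ?invr_ge0 // ln_ge0 // ler1n.
Qed.
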